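(* Let $\ell$ be a positive integer and $X$ be a disjoint union of $\ell$ circles. Given an abelian group $G$, the following conditions are equivalent: (1) $G$ is isomorphic to a subgroup of $\mathcal H(X)$ whose natural action on $X$ is minimal; (2) there is a short exact sequence of abelian groups $$0\longrightarrow H\longrightarrow G\longrightarrow K\longrightarrow 0$$ such that $H$ is (isomorphic to) a dense subgroup of $\mathbb S^1$ and $K$ has cardinality $\ell$.
   Context: $\mathcal H(X)$ denotes the group (under composition) of all homeomorphisms of $X$ onto itself; isomorphisms of groups are isomorphisms of abstract groups. The natural action on $X$ of a subgroup $G'$ of $\mathcal H(X)$ is the one in which each $g\in G'$ acts as the homeomorphism $g$ itself; it is minimal if for every $x\in X$ the orbit $\{g(x): g\in G'\}$ is dense in $X$. $\mathbb S^1$ is the circle group with its usual topology. A disjoint union of $\ell$ circles is a topological disjoint union of $\ell$ copies of $\mathbb S^1$. *)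

(* Defs.v *)
From HB Require Import structures.
From mathcomp Require Import all_boot all_order all_algebra complex.
From mathcomp Require Import all_classical all_reals all_analysis.

Set Implicit Arguments.
Unset Strict Implicit.
Unset Printing Implicit Defensive.

Import Order.TTheory GRing.Theory Num.Theory.
Import numFieldNormedType.Exports.

Local Open Scope classical_set_scope.
Local Open Scope ring_scope.
Local Open Scope complex_scope.

Definition homeomorphism (X Y : topologicalType) (f : X -> Y) : Prop :=
  continuous f /\
  exists g : Y -> X, [/\ cancel f g, cancel g f & continuous g].

Definition homeomorphic (X Y : topologicalType) : Prop :=
  exists f : X -> Y, homeomorphism f.

Record homeo (X : topologicalType) := Homeo {
  homeo_fun :> X -> X;
  homeoP : homeomorphism homeo_fun }.

Section HomeoGroup.
Variable X : topologicalType.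
Implicit Types f g h : homeo X.

Lemma homeo_eq f g : f =1 g -> f = g.
Proof.
case: f g => [f Pf] [g Pg] /= /funext fg.
by rewrite fg in Pf *; congr Homeo; exact: Prop_irrelevance.
Qed.

Lemma homeo_id_subproof : homeomorphism (@id X).
Proof. by split; [|exists id; split => //]; move=> x; exact: cvg_id. Qed.

Lemma homeo_comp_subproof f g : homeomorphism (f \o g).
Proof.
case: (homeoP f) => cf [f' [fK f'K cf']].
case: (homeoP g) => cg [g' [gK g'K cg']].
split; first by move=> x; apply: continuous_comp; [exact: cg|exact: cf].
exists (g' \o f'); split; [exact: can_comp|exact: can_comp|].
by move=> x; apply: continuous_comp; [exact: cf'|exact: cg'].
Qed.

Lemma homeo_inv_ex f : exists h, cancel f h /\ cancel h f.
Proof.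
case: (homeoP f) => cf [f' [fK f'K cf']].
have Pf' : homeomorphism f' by split => //; exists f; split.
by exists (Homeo Pf').
Qed.

Definition homeo_one : homeo X := Homeo homeo_id_subproof.
Definition homeo_mul f g : homeo X := Homeo (homeo_comp_subproof f g).
Definition homeo_inv f : homeo X := projT1 (cid (homeo_inv_ex f)).

Lemma homeo_mulA : associative homeo_mul.
Proof. by move=> f g h; exact: homeo_eq. Qed.
Lemma homeo_mul1 : left_id homeo_one homeo_mul.
Proof. by move=> f; exact: homeo_eq. Qed.
Lemma homeo_mulr1 : right_id homeo_one homeo_mul.
Proof. by move=> f; exact: homeo_eq. Qed.
Lemma homeo_mulV : left_inverse homeo_one homeo_inv homeo_mul.
Proof.
move=> f; apply: homeo_eq => x /=.
by rewrite /homeo_inv; case: cid => h [fh hf] /=; exact: fh.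
Qed.
Lemma homeo_mulrV : right_inverse homeo_one homeo_inv homeo_mul.
Proof.
move=> f; apply: homeo_eq => x /=.
by rewrite /homeo_inv; case: cid => h [fh hf] /=; exact: hf.
Qed.

HB.instance Definition _ := gen_eqMixin (homeo X).
HB.instance Definition _ := gen_choiceMixin (homeo X).
HB.instance Definition _ := isGroup.Build (homeo X)
  homeo_mulA homeo_mul1 homeo_mulr1 homeo_mulV homeo_mulrV.

End HomeoGroup.

(* [R[i]^o] is [R[i]] seen as a normed space over itself; it carries the topology
   of the modulus. *)
Definition unit_circle (R : realType) : set R[i]^o := [set z | `|z| = 1].
Arguments unit_circle R : clear implicits.

Definition circle (R : realType) : Type := set_type (unit_circle R).

HB.instance Definition _ (R : realType) :=
  Topological.copy (circle R) (set_type (unit_circle R)).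

Section CircleGroup.
Variable R : realType.
Implicit Types z w : circle R.

Definition mk_circle (z : R[i]) (hz : `|z| = 1) : circle R :=
  exist (fun x => x \in unit_circle R) z (mem_set hz).

Lemma circle_norm z : `|\val z : R[i]| = 1.
Proof. exact: set_valP z. Qed.

Lemma circle_mul_subproof z w : `|(\val z : R[i]) * \val w| = 1.
Proof. by rewrite normrM !circle_norm mulr1. Qed.

Lemma circle_inv_subproof z : `|(\val z : R[i])^-1| = 1.
Proof. by rewrite normfV circle_norm invr1. Qed.

Definition circle_one : circle R := mk_circle (normr1 _).
Definition circle_mul z w : circle R := mk_circle (circle_mul_subproof z w).
Definition circle_inv z : circle R := mk_circle (circle_inv_subproof z).

Lemma circle_neq0 z : (\val z : R[i]) != 0.
Proof. by rewrite -normr_eq0 circle_norm oner_eq0. Qed.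

Lemma circle_mulA : associative circle_mul.
Proof. by move=> x y z; apply: val_inj; rewrite /= mulrA. Qed.
Lemma circle_mul1 : left_id circle_one circle_mul.
Proof. by move=> x; apply: val_inj; rewrite /= mul1r. Qed.
Lemma circle_mulr1 : right_id circle_one circle_mul.
Proof. by move=> x; apply: val_inj; rewrite /= mulr1. Qed.
Lemma circle_mulV : left_inverse circle_one circle_inv circle_mul.
Proof. by move=> x; apply: val_inj; rewrite /= mulVf ?circle_neq0. Qed.
Lemma circle_mulrV : right_inverse circle_one circle_inv circle_mul.
Proof. by move=> x; apply: val_inj; rewrite /= mulfV ?circle_neq0. Qed.

HB.instance Definition _ := isGroup.Build (circle R)
  circle_mulA circle_mul1 circle_mulr1 circle_mulV circle_mulrV.

End CircleGroup.

Definition disjoint_union_of_circles (R : realType) (l : nat)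
    (X : topologicalType) : Prop :=
  homeomorphic X {i : 'I_l & circle R}.

Local Open Scope group_scope.

Definition abelian_group (G : groupType) : Prop :=
  forall x y : G, commute x y.

Definition subgroup (G : groupType) (S : set G) : Prop :=
  [/\ S 1, forall x y, S x -> S y -> S (x * y) & forall x, S x -> S x^-1].

Definition isomorphic_to_subgroup (G H : groupType) (S : set H) : Prop :=
  exists f : {multiplicative G -> H}, set_bij [set: G] S f.

Definition minimal_action (X : topologicalType) (S : set (homeo X)) : Prop :=
  forall x : X, dense [set g x | g in S].

Definition short_exact (H G K : groupType)
    (i : {multiplicative H -> G}) (p : {multiplicative G -> K}) : Prop :=
  [/\ injective i, range i = p @^-1` [set 1] & range p = [set: K]].

(* Main.v *)
Require Import Defs.
From HB Require Import structures.
From mathcomp Require Import all_boot all_order all_algebra complex.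
From mathcomp Require Import all_classical all_reals all_analysis.
From mathcomp Require Import zify ring lra.

(* (1) => (2).  Fixed-point sets of elements of [G] are closed and, [G] being
   abelian, [G]-invariant; so a faithful minimal action is free.  [G] permutes
   the circles transitively, and the stabiliser [H] of one of them acts freely
   on it, with [G / H] of cardinality [l].  The rotation number embeds [H] in
   the circle group: a map [h] without fixed points has a canonical lift
   [t |-> t + D t] with [0 < D < 1], where [D] is the logarithm of [h z / z];
   hence displacements of lifts vary by at most 1, lifts of commuting maps
   commute, and translation numbers are additive, and not integral for [h <> 1].
   The image is dense because it is infinite, [H] having an infinite orbit.

   (2) => (1).  [G] acts on the circle bundle [G x_H circle] over [K = G / H]. *)

Set Implicit Arguments.
Unset Strict Implicit.
Unset Printing Implicit Defensive.

Import Order.TTheory GRing.Theory Num.Theory.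
Import numFieldNormedType.Exports.

Local Open Scope classical_set_scope.
Local Open Scope ring_scope.

(** * Real coordinates and topology of the circle group *)

Section CircleCoordinates.
Variable R : realType.
Implicit Types (z w : circle R) (t s : R).

Definition circle_re z : R := complex.Re (\val z : R[i]).
Definition circle_im z : R := complex.Im (\val z : R[i]).

Lemma circle_ext z w :
  circle_re z = circle_re w -> circle_im z = circle_im w -> z = w.
Proof.
rewrite /circle_re /circle_im => h1 h2; apply: val_inj.
by move: h1 h2; case: (\val z) => a b; case: (\val w) => c d /= -> ->.
Qed.

Lemma circle_sqr z : circle_re z ^+ 2 + circle_im z ^+ 2 = 1.
Proof.
have := circle_norm z; rewrite normc_def => /eqP.
rewrite eq_complex /= eqxx andbT => /eqP h.
have /sqr_sqrtr <- : 0 <= circle_re z ^+ 2 + circle_im z ^+ 2.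
  by rewrite addr_ge0 ?sqr_ge0.
by rewrite /circle_re /circle_im h expr1n.
Qed.

Lemma circle_reM z w : circle_re (z * w)%g =
  circle_re z * circle_re w - circle_im z * circle_im w.
Proof.
by rewrite /circle_re /circle_im /=; case: (\val z) => a b; case: (\val w).
Qed.

Lemma circle_imM z w : circle_im (z * w)%g =
  circle_re z * circle_im w + circle_im z * circle_re w.
Proof.
by rewrite /circle_re /circle_im /=; case: (\val z) => a b; case: (\val w).
Qed.

Lemma circle_re1 : circle_re 1%g = 1. Proof. by []. Qed.
Lemma circle_im1 : circle_im 1%g = 0. Proof. by []. Qed.

Lemma circle_reV z : circle_re z^-1%g = circle_re z.
Proof.
have := circle_sqr z; rewrite /circle_re /circle_im /=.
by case: (\val z) => a b /= ->; rewrite divr1.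
Qed.

Lemma circle_imV z : circle_im z^-1%g = - circle_im z.
Proof.
have := circle_sqr z; rewrite /circle_re /circle_im /=.
by case: (\val z) => a b /= ->; rewrite divr1.
Qed.

Lemma circle_mulC z w : (z * w)%g = (w * z)%g.
Proof. by apply: val_inj; rewrite /= mulrC. Qed.

Lemma complex_Re_continuous : continuous (@complex.Re R : R[i]^o -> R).
Proof.
move=> z U /nbhs_ballP[e /= e0 eU].
apply/nbhs_ballP; exists e%:C%C => /=; first by rewrite ltcR.
move=> w zw; apply: eU; move: zw; rewrite -!ball_normE /= -(ltcR _ e).
by apply: le_lt_trans; have := normc_ge_Re (z - w); case: z w => [? ?] [? ?].
Qed.

Lemma complex_Im_continuous : continuous (@complex.Im R : R[i]^o -> R).
Proof.
move=> z U /nbhs_ballP[e /= e0 eU].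
apply/nbhs_ballP; exists e%:C%C => /=; first by rewrite ltcR.
move=> w zw; apply: eU; move: zw; rewrite -!ball_normE /= -(ltcR _ e).
apply: le_lt_trans; case: z w => [a b] [c d]; rewrite normc_def lecR -sqrtr_sqr.
by rewrite ler_sqrt ?addr_ge0 ?sqr_ge0// lerDr sqr_ge0.
Qed.

Lemma circle_re_continuous : continuous circle_re.
Proof.
move=> z; apply: continuous_comp (@complex_Re_continuous _).
exact: initial_continuous.
Qed.

Lemma circle_im_continuous : continuous circle_im.
Proof.
move=> z; apply: continuous_comp (@complex_Im_continuous _).
exact: initial_continuous.
Qed.

(** The circle has the initial topology of its inclusion in [R[i]], and there the modulus is
    controlled by the two coordinates. *)
Lemma continuous_circle (T : topologicalType) (f : T -> circle R) :
  continuous (circle_re \o f) -> continuous (circle_im \o f) -> continuous f.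
Proof.
move=> cr ci; apply: continuous_comp_initial => x U /nbhs_ballP[e /= e0].
(* A positive element of [R[i]] has zero imaginary part, so the radius of a ball is a real
   number. *)
have [r r0 ->] : exists2 r, 0 < r & e = r%:C%C :> R[i].
  move: e0; rewrite ltcE /= => /andP[/eqP e2 e1].
  by exists (complex.Re e) => //; case: e e2 {e1} => a b /= ->.
move=> rU; suff : \forall y \near x, U ((set_val \o f) y) by [].
near=> y; apply: rU; rewrite -ball_normE /= normc_def ltcR.
rewrite -[ltRHS]gtr0_norm // -sqrtr_sqr ltr_sqrt; last by rewrite exprn_gt0.
have yr : `|circle_re (f x) - circle_re (f y)| < r / 2.
  near: y; move/cvgrPdist_lt : (cr x); apply; exact: divr_gt0.
have yi : `|circle_im (f x) - circle_im (f y)| < r / 2.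
  near: y; move/cvgrPdist_lt : (ci x); apply; exact: divr_gt0.
move: yr yi; rewrite /circle_re /circle_im !raddfB/= set_valE.
set a := complex.Re _ - _; set b := complex.Im _ - _.
by rewrite !ltr_norml => /andP[? ?] /andP[? ?]; nra.
Unshelve. all: by end_near. Qed.

Lemma continuous_circle_div (T : topologicalType) (f g : T -> circle R) :
  continuous f -> continuous g -> continuous (fun x => f x * (g x)^-1)%g.
Proof.
move=> cf cg.
have fr x := continuous_comp (cf x) (@circle_re_continuous _).
have fi x := continuous_comp (cf x) (@circle_im_continuous _).
have gr x := continuous_comp (cg x) (@circle_re_continuous _).
have gi x := continuous_comp (cg x) (@circle_im_continuous _).
apply: continuous_circle => x.
  rewrite (_ : _ \o _ = fun y => circle_re (f y) * circle_re (g y) +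
      circle_im (f y) * circle_im (g y)); last first.
    apply/funext => v /=.
    by rewrite circle_reM circle_reV circle_imV mulrN opprK.
  by apply: cvgD; apply: cvgM; [exact: fr|exact: gr|exact: fi|exact: gi].
rewrite (_ : _ \o _ = fun y => circle_im (f y) * circle_re (g y) -
    circle_re (f y) * circle_im (g y)); last first.
  apply/funext => v /=.
  by rewrite circle_imM circle_reV circle_imV mulrN addrC.
by apply: cvgB; apply: cvgM; [exact: fi|exact: gr|exact: fr|exact: gi].
Qed.

Lemma circle_mul_continuous z : continuous (fun w => z * w)%g.
Proof.
rewrite (_ : (fun w => _) = fun w : circle R => w * z^-1^-1)%g; last first.
  by apply/funext => w; rewrite invgK circle_mulC.
by apply: continuous_circle_div; [move=> w; exact: cvg_id|exact: cst_continuous].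
Qed.

Lemma circle_hausdorff : hausdorff_space (circle R).
Proof.
move=> z w zw; apply: circle_ext.
  apply: (@norm_hausdorff R R) => A B Az Bw.
  have [v [Av Bv]] := zw _ _ (circle_re_continuous Az) (circle_re_continuous Bw).
  by exists (circle_re v).
apply: (@norm_hausdorff R R) => A B Az Bw.
have [v [Av Bv]] := zw _ _ (circle_im_continuous Az) (circle_im_continuous Bw).
by exists (circle_im v).
Qed.

End CircleCoordinates.

(** * The covering of the circle by the line, and a logarithm *)

Section CircleParametrisation.
Variable R : realType.
Implicit Types (z w : circle R) (t s : R).

Lemma cis_norm t : `|(cos t +i* sin t)%C : R[i]| = 1.
Proof. by rewrite normc_def /= cos2Dsin2 sqrtr1. Qed.

(** This is [exp (2 i pi t)]: angles are counted in turns, so that the kernel consists of the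
    integers. *)
Definition cis t : circle R := mk_circle (cis_norm (pi *+ 2 * t)).

Lemma cis_re t : circle_re (cis t) = cos (pi *+ 2 * t). Proof. by []. Qed.

Lemma cis_im t : circle_im (cis t) = sin (pi *+ 2 * t). Proof. by []. Qed.

Lemma cisD t s : cis (t + s) = (cis t * cis s)%g.
Proof.
apply: circle_ext.
  by rewrite circle_reM !cis_re !cis_im mulrDr cosD.
by rewrite circle_imM !cis_re !cis_im mulrDr sinD addrC.
Qed.

Lemma cis0 : cis 0 = 1%g.
Proof.
apply: circle_ext.
  by rewrite cis_re mulr0 cos0.
by rewrite cis_im mulr0 sin0.
Qed.

Lemma cisN t : cis (- t) = (cis t)^-1%g.
Proof. by apply: (mulgI (cis t)); rewrite -cisD subrr cis0 mulgV. Qed.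

Lemma cis1 : cis 1 = 1%g.
Proof.
apply: circle_ext.
  by rewrite cis_re mulr1 cos2pi.
by rewrite cis_im mulr1 sin2pi.
Qed.

Lemma cis_nat n : cis n%:R = 1%g.
Proof.
by elim: n => [|n ih]; rewrite ?cis0// mulrS cisD ih cis1 mulg1.
Qed.

Lemma cis_int (m : int) : cis m%:~R = 1%g.
Proof.
by case: m => n; rewrite ?NegzE ?mulrNz ?cisN cis_nat ?invg1.
Qed.

Lemma cis_continuous : continuous cis.
Proof.
apply: continuous_circle => t.
  apply: (@continuous_comp _ _ _ ( *%R (pi *+ 2)) cos).
    exact: mulrl_continuous.
  exact: continuous_cos.
apply: (@continuous_comp _ _ _ ( *%R (pi *+ 2)) sin).
  exact: mulrl_continuous.
exact: continuous_sin.
Qed.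

Lemma circle_re_lt1 z : z <> 1%g -> circle_re z < 1.
Proof.
move=> z1; have zz := circle_sqr z.
have [//|re1] := ltP (circle_re z) 1; case: z1.
by apply: circle_ext; rewrite ?circle_re1 ?circle_im1; nra.
Qed.

(* If [z = exp (2 i pi t)] with [0 < t < 1] then
   [im z / (1 - re z) = cot (pi t) = tan (pi / 2 - pi t)]. *)
Definition circle_log z : R :=
  2^-1 - pi^-1 * atan (circle_im z / (1 - circle_re z)).

Lemma circle_log_itv z : 0 < circle_log z < 1.
Proof.
rewrite /circle_log; set a := atan _.
have p0 := pi_gt0 R.
have a1 : - (pi / 2) < a by exact: atan_gtNpi2.
have a2 : a < pi / 2 by exact: atan_ltpi2.
have pV : pi^-1 * pi = 1 :> R by rewrite mulVf// gt_eqF.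
have pV0 : 0 < pi^-1 :> R by rewrite invr_gt0.
by apply/andP; split; nra.
Qed.

Lemma circle_logK z : z <> 1%g -> cis (circle_log z) = z.
Proof.
move=> /circle_re_lt1 z1; have zz := circle_sqr z.
have p0 := pi_gt0 R.
pose u := atan (circle_im z / (1 - circle_re z)).
have tu : tan u = circle_im z / (1 - circle_re z) by exact: atanK.
have cu : 0 < cos u by rewrite cos_gt0_pihalf// atan_gtNpi2 atan_ltpi2.
(* The double-angle formulas now recover both coordinates of [z] from [tan u]. *)
have E : pi *+ 2 * circle_log z = pi - u *+ 2.
  rewrite /circle_log -/u; field; lra.
have su : sin u = cos u * (circle_im z / (1 - circle_re z)).
  by rewrite -tu /tan; field; lra.
have c2 : cos u ^+ 2 = (1 - circle_re z) / 2.
  have := cos2Dsin2 u; rewrite su.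
  set c := cos u; set x := circle_re z in zz z1 *; set y := circle_im z in zz *.
  move=> h.
  (* Pythagoras for [u], cleared of its denominator. On the circle the second factor equals
     [2 * (1 - x)], and one factor [1 - x] cancels. *)
  have : c ^+ 2 * ((1 - x) ^+ 2 + y ^+ 2) = (1 - x) ^+ 2.
    rewrite -[RHS]mulr1 -[X in _ = _ * X]h; field; lra.
  rewrite (_ : (1 - x) ^+ 2 + y ^+ 2 = 2 * (1 - x)); last by nra.
  have x1 : 1 - x != 0 by lra.
  by move=> {}h; nra.
apply: circle_ext; rewrite ?cis_re ?cis_im E.
  rewrite cosB cospi sinpi mul0r addr0 mulN1r cos_mulr2n c2; lra.
rewrite sinB cospi sinpi mul0r sub0r mulN1r opprK sin_mulr2n su.
rewrite mulrA -expr2 c2; field; lra.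
Qed.

Lemma cis_surj z : exists t, cis t = z.
Proof.
have [->|z1] := pselect (z = 1%g); first by exists 0; rewrite cis0.
by exists (circle_log z); exact: circle_logK.
Qed.

(** Here [cos (2 pi t) = 1 - 2 sin (pi t) ^+ 2], and [sin (pi t)] is positive. *)
Lemma cis_neq1 t : 0 < t < 1 -> cis t <> 1%g.
Proof.
move=> t01 /(congr1 (@circle_re R)); rewrite cis_re circle_re1.
have -> : pi *+ 2 * t = (pi * t) *+ 2 by rewrite mulrnAl.
rewrite cos_mulr2n cos2sin2 => h.
have : 0 < sin (pi * t).
  apply: sin_gt0_pi; have := pi_gt0 R; move: t01 => /andP[? ?] ?.
  by apply/andP; split; nra.
by nra.
Qed.

Lemma cis_inj_itv t s : 0 <= t < 1 -> 0 <= s < 1 -> cis t = cis s -> t = s.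
Proof.
wlog ts : t s / t <= s.
  move=> h t0 s0 e; have [|st] := leP t s; first by move/h; exact.
  by apply/esym/h => //; exact: ltW.
move=> /andP[t0 t1] /andP[s0 s1] e.
have [//|nts] := eqVneq t s; have {nts} : t < s by rewrite lt_neqAle nts.
move=> {}ts; have /cis_neq1[] : 0 < s - t < 1 by apply/andP; split; lra.
by rewrite cisD cisN e mulgV.
Qed.

Lemma cis_floor t : cis (t - (Num.floor t)%:~R) = cis t.
Proof. by rewrite cisD cisN cis_int invg1 mulg1. Qed.

(** The fractional part of [t] has the same image under [cis], which is injective on [[0, 1)].
    Integrality is expressed by equality with the floor. *)
Lemma cis_eq1 t : cis t = 1%g -> t = (Num.floor t)%:~R.
Proof.
rewrite -cis_floor -cis0 => /cis_inj_itv h; apply/subr0_eq/h.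
  by rewrite subr_ge0 floor_le ltrBlDl -[1]/(1%:~R) -intrD floorD1_gt.
by rewrite lexx ltr01.
Qed.

(** The denominator [1 - circle_re z] in the logarithm vanishes on the circle only at [1]. *)
Lemma circle_continuous_comp_log (T : topologicalType) (f : T -> circle R) :
  continuous f -> (forall x, f x <> 1%g) -> continuous (circle_log \o f).
Proof.
move=> cf f1 x.
have cr : {for x, continuous (@circle_re R \o f)}.
  exact: continuous_comp (cf x) (@circle_re_continuous _ _).
have ci : {for x, continuous (@circle_im R \o f)}.
  exact: continuous_comp (cf x) (@circle_im_continuous _ _).
apply: cvgB; first exact: cvg_cst.
apply: cvgMl_tmp; apply: continuous_cvg; first exact: continuous_atan.
apply: cvgM; first exact: ci.
apply: cvgV; first by have := circle_re_lt1 (f1 x); lra.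
by apply: cvgB; [exact: cvg_cst|exact: cr].
Qed.

End CircleParametrisation.

(** * Locally constant functions on the line *)

Section LocallyConstant.
Variable R : realType.

(** The fibre through [t] is open and closed in the connected line. As [T] carries no topology, this
    serves both for real values and for indices of circles. *)
Lemma locally_constantE (T : Type) (f : R -> T) :
  (forall t, \forall s \near t, f s = f t) -> forall s t, f s = f t.
Proof.
move=> fl s t.
have cT : connected [set: R] by apply/connected_intervalP.
suff /(congr1 (fun A => A s)) : [set u | f u = f t] = setT.
  by rewrite /= => ->.
apply: cT; first by exists t.
- exists [set u | f u = f t]; last by rewrite setTI.
  by rewrite openE => u /= <-; exact: fl.
- exists [set u | f u = f t]; last by rewrite setTI.
  rewrite -[X in closed X]setCK; apply: open_closedC.
  rewrite openE => u /= ut; near=> v => /= vt; apply: ut; rewrite -vt.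
  by apply/esym; near: v; exact: fl.
Unshelve. all: by end_near. Qed.

Lemma continuous_int_constant (f : R -> R) :
  continuous f -> (forall t, f t = (Num.floor (f t))%:~R) ->
  exists m : int, forall t, f t = m%:~R.
Proof.
move=> cf fi; exists (Num.floor (f 0)) => t.
rewrite -fi; apply: locally_constantE => {}t; near=> s.
have : `|f t - f s| < 1 by near: s; move/cvgrPdist_lt : (cf t); apply.
rewrite (fi t) (fi s) -intrB -intr_norm -[ltRHS]/(1%:~R) ltr_int => h.
by congr (_%:~R); lia.
Unshelve. all: by end_near. Qed.

End LocallyConstant.

(** * Quasi-additive sequences and their slopes *)

Section QuasiAdditive.
Variable R : realType.
Implicit Types (u : nat -> R) (C : R).

Lemma linear_bounded_le0 (a C : R) : (forall n, n%:R * a <= C) -> a <= 0.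
Proof.
move=> h; rewrite leNgt; apply/negP => a0.
have := truncnS_gt (C / a); rewrite ltr_pdivrMr// => /lt_le_trans/(_ (h _)).
by rewrite ltxx.
Qed.

Lemma linear_growth_uniq u (a b C : R) :
  (forall n, `|u n - n%:R * a| <= C) -> (forall n, `|u n - n%:R * b| <= C) ->
  a = b.
Proof.
move=> ua ub; apply/eqP; rewrite eq_le.
apply/andP; split; rewrite -subr_le0; apply: (@linear_bounded_le0 _ (2 * C)) => n;
  by have := ua n; have := ub n; rewrite !ler_norml => /andP[? ?] /andP[? ?]; lra.
Qed.

(* The slope is [sup_n (u n - 1) / n]: comparing [u (m * n)] with both [m u n]
   and [n u m] gives [(u n - 1) / n <= (u m + 1) / m]. *)
Lemma quasi_additive_slope u : u 0%N = 0 ->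
  (forall m n, `|u (m + n)%N - u m - u n| <= 1) ->
  exists a, forall n, `|u n - n%:R * a| <= 1.
Proof.
move=> u0 hu.
(* Induction on [m], with an error of at most 1 per added term. *)
have hM m n : `|u (m * n)%N - m%:R * u n| <= m%:R.
  elim: m => [|m ih]; first by rewrite mul0n u0 mul0r subrr normr0.
  have := hu n (m * n)%N; rewrite mulSn -natr1 => h1.
  by move: h1 ih; rewrite !ler_norml => /andP[? ?] /andP[? ?];
    apply/andP; split; nra.
have cross m n : m%:R * (u n - 1) <= n%:R * (u m + 1).
  have := hM m n; have := hM n m; rewrite mulnC.
  by rewrite !ler_norml => /andP[? ?] /andP[? ?]; nra.
(* Indices are shifted to avoid division by zero; [u 0%N = 0] settles the remaining index. *)
pose A := [set (u n.+1 - 1) / n.+1%:R | n in [set: nat]].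
have Aub m : ubound A ((u m.+1 + 1) / m.+1%:R).
  move=> _ [n _ <-]; rewrite ler_pdivrMr ?ltr0n// mulrAC ler_pdivlMr ?ltr0n//.
  by rewrite mulrC [leRHS]mulrC cross.
have supA : has_sup A.
  by split; [exists ((u 1%N - 1) / 1%:R), 0%N|exists ((u 1%N + 1) / 1%:R)].
exists (sup A); case=> [|n]; first by rewrite u0 mul0r subrr normr0.
have h1 : (u n.+1 - 1) / n.+1%:R <= sup A.
  by apply: sup_upper_bound => //; exists n.
have h2 : sup A <= (u n.+1 + 1) / n.+1%:R.
  by apply: ge_sup => //; case: supA.
move: h1 h2; rewrite ler_pdivrMr ?ltr0n// ler_pdivlMr ?ltr0n// => h1 h2.
by rewrite ler_norml; apply/andP; split; lra.
Qed.

End QuasiAdditive.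

(** * Rotation numbers for free actions of an abelian group on the circle *)

Section FreeCircleAction.
Variables (R : realType) (H : groupType) (a : H -> circle R -> circle R).
Hypotheses (abH : abelian_group H) (a1 : forall z, a 1%g z = z).
Hypothesis aM : forall x y z, a (x * y)%g z = a x (a y z).
Hypothesis ac : forall x, continuous (a x).
Hypothesis free : forall x z, a x z = z -> x = 1%g.
Implicit Types (x y : H) (F G : R -> R) (m : int).

(** A lift of [a x] to the universal cover [cis]. Compatibility with integer translations is not
    assumed; it is derived in [lift_int]. *)
Definition lift x F := continuous F /\ forall t, cis (F t) = a x (cis t).

(** The difference of two lifts is continuous and takes integer values, hence is constant. *)
Lemma lift_uniq x F G : lift x F -> lift x G ->
  exists m, forall t, F t = G t + m%:~R.
Proof.
move=> [cF lF] [cG lG].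
have [m hm] : exists m, forall t, F t - G t = m%:~R.
  apply: continuous_int_constant => t; first by apply: cvgB; [exact: cF|exact: cG].
  by apply: cis_eq1; rewrite cisD cisN lF lG mulgV.
by exists m => t; rewrite -(hm t) addrC subrK.
Qed.

Lemma lift_shift x F m : lift x F -> lift x (fun t => F t + m%:~R).
Proof.
move=> [cF lF]; split=> t; last by rewrite cisD cis_int mulg1 lF.
by apply: cvgD; [exact: cF|exact: cvg_cst].
Qed.

Lemma lift1 m : lift 1%g (fun t => t + m%:~R).
Proof.
apply: (@lift_shift 1%g id); split=> t; last by rewrite a1.
exact: cvg_id.
Qed.

Lemma lift_comp x y F G : lift x F -> lift y G -> lift (x * y)%g (F \o G).
Proof.
move=> [cF lF] [cG lG]; split=> t; last by rewrite /= lF lG aM.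
exact: continuous_comp (cG t) (cF _).
Qed.

Lemma lift_iter x F n : lift x F -> lift (x ^+ n)%g (iter n F).
Proof.
move=> lF; elim: n => [|n ih]; last by rewrite expgS; exact: lift_comp.
have := lift1 0; rewrite (_ : (fun t => _) = id)//.
by apply/funext => t; rewrite addr0.
Qed.

(* Since [x] has no fixed point, the logarithm of [a x z / z] is globally
   defined; this replaces path lifting. *)
Lemma lift_nontrivial x : x <> 1%g ->
  exists F, lift x F /\
    exists2 e, 0 < e & forall t, e <= F t - t <= 1 - e.
Proof.
move=> x1; pose D t := circle_log (a x (cis t) * (cis t)^-1)%g.
have neq1 t : (a x (cis t) * (cis t)^-1)%g <> 1%g.
  move=> /(congr1 (fun z => z * cis t)%g); rewrite mulgVK mul1g.
  by move/free.
have cD : continuous D.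
  apply: (@circle_continuous_comp_log _ _
    (fun t => a x (cis t) * (cis t)^-1)%g) => //.
  apply: continuous_circle_div => t; last exact: cis_continuous.
  exact: continuous_comp (@cis_continuous _ t) (@ac _ _).
have cDW : {within `[0, 1], continuous D} by exact: continuous_subspaceT.
have [s _ hs] := EVT_min ler01 cDW.
have [r _ hr] := EVT_max ler01 cDW.
(* By periodicity the extrema of [D] over [[0, 1]] are global. *)
have Dper t : D (t - (Num.floor t)%:~R) = D t by rewrite /D cis_floor.
have Dbd t : D s <= D t <= D r.
  have t01 : t - (Num.floor t)%:~R \in `[0, 1].
    rewrite in_itv /= subr_ge0 floor_le lerBlDl.
    by rewrite -[1]/(1%:~R) -intrD ltW// floorD1_gt.
  by rewrite -(Dper t) hs ?hr.
exists (fun t => t + D t); split.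
  split=> t; first by apply: cvgD; [exact: cvg_id|exact: cD].
  by rewrite cisD circle_logK// circle_mulC mulgVK.
(* A margin uniform in [t]: it survives averaging over iterates and later keeps translation numbers
   strictly between 0 and 1. *)
exists (Num.min (D s) (1 - D r)).
  have /andP[s0 _] : 0 < D s < 1 by exact: circle_log_itv.
  have /andP[_ r1] : 0 < D r < 1 by exact: circle_log_itv.
  by rewrite lt_min s0 subr_gt0.
move=> t; rewrite (addrC t) addrK; have /andP[h1 h2] := Dbd t.
have h3 : Num.min (D s) (1 - D r) <= D s by rewrite ge_min lexx.
have h4 : Num.min (D s) (1 - D r) <= 1 - D r by rewrite ge_min lexx orbT.
by apply/andP; split; lra.
Qed.

Lemma lift_ex x : exists F, lift x F.
Proof.
have [->|/lift_nontrivial[F [lF _]]] := pselect (x = 1%g); last by exists F.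
by exists (fun t => t + 0%:~R); exact: lift1.
Qed.

(** Up to an integer constant, [F] is the identity if [x = 1], and otherwise a lift whose
    displacement stays in [(0, 1)]. *)
Lemma lift_displacement x F s t : lift x F ->
  `|(F s - s) - (F t - t)| <= 1.
Proof.
move=> lF; have [x1|/lift_nontrivial[G [lG [e e0 he]]]] := pselect (x = 1%g).
  move: lF; rewrite x1 => /lift_uniq/(_ (lift1 0))[m hm].
  by rewrite !hm addrC; rewrite (_ : _ + _ = 0) ?normr0//; ring.
have [m hm] := lift_uniq lF lG; rewrite !hm.
have /andP[? ?] := he s; have /andP[? ?] := he t.
by rewrite ler_norml; apply/andP; split; lra.
Qed.

(** Turns displacement bounds into exact identities: an integer defect is amplified until it would
    exceed the bound. *)
Lemma int_eq0 m k : `|k.+2%:R * m%:~R : R| <= k.+1%:R -> m = 0.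
Proof.
rewrite -[k.+2%:R]/(k.+2%:~R) -[k.+1%:R]/(k.+1%:~R) -intrM -intr_norm ler_int.
by move=> h; nia.
Qed.

(** If [F] gained [k] over a unit interval, its displacements at [2] and [0] would differ by
    [2 * (k - 1)]; the bound 1 on this difference forces [k = 1]. *)
Lemma lift_int x F t m : lift x F -> F (t + m%:~R) = F t + m%:~R.
Proof.
move=> lF.
have step : forall t, F (t + 1) = F t + 1.
  have l1 : lift x (fun t => F (t + 1)).
    by rewrite -[x]mulg1; apply: lift_comp lF (lift1 1).
  have [k hk] := lift_uniq l1 lF.
  suff : k = 1 by move=> k1 u; rewrite hk k1.
  apply/subr0_eq/(@int_eq0 _ 0); rewrite intrB.
  have := lift_displacement 2 0 lF.
  have -> : F 2 = F 0 + 2 * k%:~R.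
    by rewrite -[2 in LHS]add0r [0 + _]addrA !hk; ring.
  by congr (`| _ | <= _); ring.
have stepN : forall n t, F (t + n%:R) = F t + n%:R.
  elim=> [|n ih] u; first by rewrite !addr0.
  by rewrite -natr1 addrA step ih addrA.
case: m => n; first exact: stepN.
rewrite NegzE mulrNz; apply: (addIr n.+1%:R).
by rewrite -stepN !subrK.
Qed.

(** The commutator defect is an integer [m], and moving [G] past [n] copies of [F] costs [n] times
    [m]. *)
Lemma lift_commute x y F G t : lift x F -> lift y G -> F (G t) = G (F t).
Proof.
move=> lF lG.
have [m hm] : exists m, forall t, F (G t) = G (F t) + m%:~R.
  apply: lift_uniq (lift_comp lF lG) _; rewrite abH; exact: lift_comp.
have hn n u : iter n F (G u) = G (iter n F u) + (m *+ n)%:~R.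
  elim: n u => [|n ih] u; first by rewrite mulr0n addr0.
  rewrite iterS ih (lift_int _ _ lF) hm -addrA -intrD /= mulrS.
  by [].
rewrite hm; suff -> : m = 0 by rewrite addr0.
(* Two displacement bounds, one for the third iterate of [F] and one for [G], leave a total error of
   at most 2; three iterates are therefore enough. *)
apply: (@int_eq0 _ 1); have := lift_displacement (G 0) 0 (lift_iter 3 lF).
have := lift_displacement (iter 3 F 0) 0 lG; rewrite hn rmorphMn /=.
move: (G (iter 3 F 0)) (iter 3 F 0) (G 0) => p q r.
rewrite !ler_norml => /andP[? ?] /andP[? ?]; apply/andP; split; lra.
Qed.

(** The translation number of Poincaré, the limit of [iter n F 0 / n], encoded by a bounded error so
    that no limits have to be handled. *)
Definition trans_num F (tau : R) :=
  exists C, forall n, `|iter n F 0 - n%:R * tau| <= C.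

Lemma trans_num_uniq F tau sigma :
  trans_num F tau -> trans_num F sigma -> tau = sigma.
Proof.
move=> [C hC] [D hD].
by apply: (@linear_growth_uniq _ (fun n => iter n F 0) _ _ (Num.max C D)) => n;
  rewrite le_max ?hC ?hD ?orbT.
Qed.

(** The orbit of [0] is quasi-additive: compare the displacements of the [m]-th iterate at
    [iter n F 0] and at [0]. *)
Lemma trans_num_ex x F : lift x F -> exists tau, trans_num F tau.
Proof.
move=> lF; have [||tau ht] := @quasi_additive_slope _ (fun n => iter n F 0) => //.
  move=> m n; have := lift_displacement (iter n F 0) 0 (lift_iter m lF).
  by rewrite -iterD; congr (`| _ | <= _); ring.
by exists tau, 1.
Qed.

(** As lifts commute, iterates of the composite split as [iter n F (iter n G 0)]; one displacement
    bound then adds 1 to the two errors. *)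
Lemma trans_num_comp x y F G tau sigma : lift x F -> lift y G ->
  trans_num F tau -> trans_num G sigma -> trans_num (F \o G) (tau + sigma).
Proof.
move=> lF lG [C hC] [D hD]; exists (C + D + 1) => n.
have -> : iter n (F \o G) 0 = iter n F (iter n G 0).
  elim: n => // n ih; rewrite iterS ih /= -(lift_commute _ (lift_iter n lF) lG).
  by [].
have := lift_displacement (iter n G 0) 0 (lift_iter n lF).
have := hC n; have := hD n.
move: (iter n F (iter n G 0)) (iter n F 0) (iter n G 0) => p q r.
rewrite !ler_norml => /andP[? ?] /andP[? ?] /andP[? ?].
by apply/andP; split; lra.
Qed.

Lemma trans_num_int m : trans_num (fun t => t + m%:~R) m%:~R.
Proof.
exists 0 => n; rewrite (_ : iter _ _ _ = n%:R * m%:~R) ?subrr ?normr0//.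
by elim: n => [|n /= ->]; rewrite ?mul0r// -natr1; ring.
Qed.

(** Changing the lift adds an integer to the translation number, and [cis] forgets it. *)
Lemma trans_num_lift_uniq x F G tau sigma : lift x F -> lift x G ->
  trans_num F tau -> trans_num G sigma -> cis tau = cis sigma.
Proof.
move=> lF lG rF rG; have [m hm] := lift_uniq lF lG.
have := trans_num_comp (lift1 m) lG (trans_num_int m) rG.
rewrite (_ : _ \o _ = F); last by apply/funext.
by move/(trans_num_uniq rF) ->; rewrite cisD cis_int mul1g.
Qed.

(** For the lift [G] with margin [e], the iterates stay between [n * e] and [n * (1 - e)], so its
    translation number lies in [[e, 1 - e]]. *)
Lemma trans_num_nontrivial x F tau : x <> 1%g -> lift x F -> trans_num F tau ->
  cis tau <> 1%g.
Proof.
move=> x1 lF rF; have [G [lG [e e0 he]]] := lift_nontrivial x1.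
have [sigma rG] := trans_num_ex lG.
rewrite (trans_num_lift_uniq lF lG rF rG); apply: cis_neq1.
have hn n : n%:R * e <= iter n G 0 <= n%:R * (1 - e).
  elim: n => [|n /andP[h1 h2]]; first by rewrite !mul0r lexx.
  have /andP[h3 h4] := he (iter n G 0); rewrite iterS -natr1.
  by apply/andP; split; lra.
have [C hC] := rG; rewrite -subr_lt0 -[sigma < 1]subr_lt0.
apply/andP; split.
  suff : e - sigma <= 0 by lra.
  apply: (@linear_bounded_le0 _ _ C) => n.
  by have := hC n; have /andP[? ?] := hn n; rewrite ler_norml => /andP[? ?]; lra.
suff : sigma - (1 - e) <= 0 by lra.
apply: (@linear_bounded_le0 _ _ C) => n.
by have := hC n; have /andP[? ?] := hn n; rewrite ler_norml => /andP[? ?]; lra.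
Qed.

(** The map [rho] is the rotation number. The lifts are chosen without regard to products, but after
    [cis] the choice no longer matters. *)
Theorem free_circle_action_embeds : exists rho : H -> circle R,
  {morph rho : x y / (x * y)%g} /\ injective rho.
Proof.
have /choice[F lF] := lift_ex.
have /choice[tau rF] : forall x, exists tau, trans_num (F x) tau.
  by move=> x; exact: trans_num_ex (lF x).
have rhoM : {morph (fun x => cis (tau x)) : x y / (x * y)%g}.
  move=> x y /=; rewrite -cisD.
  apply: trans_num_lift_uniq (lF _) (lift_comp (lF x) (lF y)) (rF _) _.
  exact: trans_num_comp (lF x) (lF y) (rF x) (rF y).
exists (fun x => cis (tau x)); split=> // x y /= xy.
apply: (mulIg y^-1%g); rewrite mulgV; apply: contrapT.
move=> /trans_num_nontrivial/(_ (lF _) (rF _)); apply.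
apply: (mulIg (cis (tau y))); rewrite -rhoM mulgVK mul1g; exact: xy.
Qed.

End FreeCircleAction.

(** * Density of infinite subgroups of the circle *)

Section DenseSubgroups.
Variable R : realType.
Implicit Types (D : set (circle R)) (t : R).

Lemma circle_angle (z : circle R) : exists t, 0 <= t < 1 /\ cis t = z.
Proof.
have [t <-] := cis_surj z; exists (t - (Num.floor t)%:~R).
rewrite cis_floor subr_ge0 floor_le ltrBlDl; split=> //.
by rewrite -[1]/(1%:~R) -intrD floorD1_gt.
Qed.

Lemma circle_infinite : infinite_set [set: circle R].
Proof.
(* The shift by 2 keeps all angles in [[0, 1)], where [cis] is injective. *)
pose f n : circle R := cis n.+2%:R^-1.
have f_inj : injective f.
  have h n : 0 <= (n.+2%:R^-1 : R) < 1.
    by rewrite invr_ge0 ler0n invf_lt1 ?ltr1n ?ltr0n.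
  move=> m n /cis_inj_itv => /(_ (h m) (h n))/invr_inj/eqP.
  by rewrite eqr_nat => /eqP[].
move=> /(sub_finite_set (@subsetT _ (range f))) fin; apply: infinite_nat.
by rewrite -(eq_finite_set (inj_card_eq (in2W f_inj))).
Qed.

(** Pigeonhole: two elements of [D] whose angles share a cell of length [1 / N] have a quotient of
    small angle. *)
Lemma infinite_subgroup_small_angle D (N : nat) : subgroup D -> infinite_set D ->
  exists t, [/\ 0 < t, t * N%:R < 1 & D (cis t)].
Proof.
move=> [D1 DM DV] infD; apply: contrapT => noT; apply: infD.
have /choice[ang angP] := circle_angle.
pose f z := Num.truncn (ang z * N%:R).
have f_inj : {in D &, injective f}.
  move=> z w /set_mem Dz /set_mem Dw.
  wlog zw : z w Dz Dw / ang z <= ang w.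
    move=> h; have [|/ltW wz e] := leP (ang z) (ang w); first exact: h.
    exact/esym/h.
  move=> fzw; apply: contrapT => nzw; apply: noT; exists (ang w - ang z).
  have [/andP[z0 z1] cz] := angP z; have [/andP[w0 w1] cw] := angP w.
  split.
  - rewrite subr_gt0 lt_neqAle zw andbT; apply/eqP => e; apply: nzw.
    by rewrite -cz -cw e.
  - have /truncn_itv/andP[a1 _] : 0 <= ang z * N%:R by rewrite mulr_ge0.
    have /truncn_itv/andP[_ a2] : 0 <= ang w * N%:R by rewrite mulr_ge0.
    move: a1 a2; rewrite -/(f z) -/(f w) fzw -natr1 mulrBl; lra.
  - by rewrite cisD cisN cz cw; apply: DM => //; exact: DV.
rewrite -(eq_finite_set (inj_card_eq f_inj)).
(* With [N.+1] cells the weak bound [ang z * N%:R <= N%:R] suffices, and [N = 0] is covered. *)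
apply: (sub_finite_set _ (finite_II N.+1)) => _ [z Dz <-] /=.
have [/andP[z0 z1] cz] := angP z.
rewrite ltnS /f truncn_le_nat; apply: (@le_lt_trans _ _ N%:R).
  by rewrite ler_piMl// ltW.
by rewrite ltr_nat.
Qed.

(** The multiples of an angle [d] smaller than [e] form a net of mesh [d]; the last one not
    exceeding [t] is within [e] of it. *)
Lemma infinite_subgroup_dense D : subgroup D -> infinite_set D -> dense D.
Proof.
move=> sD infD O [z Oz] oO; have [D1 DM _] := sD.
have [t [/andP[t0 _] tz]] := circle_angle z.
have /nbhs_ballP[e /= e0 eO] : nbhs t (@cis R @^-1` O).
  by apply: cis_continuous; apply: open_nbhs_nbhs; rewrite tz.
have [d [d0 dN Dd]] :=
  infinite_subgroup_small_angle (Num.truncn e^-1).+1 sD infD.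
have de : d < e.
  have := truncnS_gt e^-1; rewrite -[X in X < _]mul1r ltr_pdivrMr// => h.
  by rewrite -(ltr_pM2r (ltr0Sn R (Num.truncn e^-1))); lra.
have Dn n : D (cis (n%:R * d)).
  elim: n => [|n ih]; first by rewrite mul0r cis0.
  by rewrite -natr1 mulrDl mul1r cisD; exact: DM.
have /truncn_itv/andP[] : 0 <= t / d by rewrite divr_ge0// ltW.
rewrite ler_pdivlMr// ltr_pdivrMr// -natr1; set n := Num.truncn _ => h1 h2.
exists (cis (n%:R * d)); split=> //; apply: eO.
by rewrite -ball_normE /= ltr_norml; apply/andP; split; lra.
Qed.

End DenseSubgroups.

(** * Subgroups and quotients as abstract groups *)

Section GroupConstructions.
Local Open Scope group_scope.

Lemma multiplicative_of_morph (G H : groupType) (f : G -> H) :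
  {morph f : x y / x * y} -> exists F : {multiplicative G -> H}, F =1 f.
Proof.
move=> fM.
pose F : {multiplicative G -> H} := HB.pack f (isMultiplicative.Build G H f fM).
by exists F.
Qed.

Lemma morph1 (G H : groupType) (f : G -> H) :
  {morph f : x y / x * y} -> f 1 = 1.
Proof. by move=> fM; apply: (mulgI (f 1)); rewrite -fM !mulg1. Qed.

Lemma morphV (G H : groupType) (f : G -> H) :
  {morph f : x y / x * y} -> forall x, f x^-1 = (f x)^-1.
Proof. by move=> fM x; apply: (mulgI (f x)); rewrite -fM !mulgV morph1. Qed.

Lemma subgroup_range (G H : groupType) (f : G -> H) :
  {morph f : x y / x * y} -> subgroup (range f).
Proof.
move=> fM; split; first by exists 1 => //; exact: morph1.
- by move=> _ _ [x _ <-] [y _ <-]; exists (x * y).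
- by move=> _ [x _ <-]; exists x^-1 => //; exact: morphV.
Qed.

Lemma isomorphic_to_range (G H : groupType) (f : G -> H) :
  {morph f : x y / x * y} -> injective f -> isomorphic_to_subgroup G (range f).
Proof.
move=> /multiplicative_of_morph[F FE] f_inj; exists F; split.
- by move=> x _; exists x => //; rewrite FE.
- by move=> x y _ _; rewrite !FE => /f_inj.
- by move=> _ [x _ <-]; exists x => //; rewrite FE.
Qed.

Lemma group_of_subgroup (G : groupType) (S : set G) : subgroup S ->
  exists (H : groupType) (i : {multiplicative H -> G}),
    injective i /\ range i = S.
Proof.
move=> [S1 SM SV].
pose mk x (Sx : S x) : set_type S := exist _ x (mem_set Sx).
have P (u : set_type S) : S (val u) by exact: set_valP.
pose mul u v := mk _ (SM _ _ (P u) (P v)).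
pose inv u := mk _ (SV _ (P u)).
have mulA : associative mul by move=> u v w; apply: val_inj; exact: mulgA.
have mul1 : left_id (mk _ S1) mul by move=> u; apply: val_inj; exact: mul1g.
have mulr1 : right_id (mk _ S1) mul by move=> u; apply: val_inj; exact: mulg1.
have mulV : left_inverse (mk _ S1) inv mul.
  by move=> u; apply: val_inj; exact: mulVg.
have mulrV : right_inverse (mk _ S1) inv mul.
  by move=> u; apply: val_inj; exact: mulgV.
pose H : groupType := HB.pack (set_type S)
  (isGroup.Build (set_type S) mulA mul1 mulr1 mulV mulrV).
have [i iE] : exists i : {multiplicative H -> G}, i =1 (val : set_type S -> G).
  exact: (@multiplicative_of_morph H G val).
exists H, i; split; first by move=> u v; rewrite !iE; exact: val_inj.
apply/seteqP; split=> [_ [u _ <-]|x Sx]; first by rewrite iE; exact: P.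
by exists (mk x Sx : H) => //; rewrite iE.
Qed.

(** The group law is put on [T] itself, each value of [q] standing for a coset, and is computed
    through representatives [s]. The bijection [u] records that [K] is [T]. *)
Lemma group_of_quotient (G : groupType) (T : Type) (q : G -> T) :
  abelian_group G -> range q = setT ->
  (forall x y z, q x = q y -> q (z * x) = q (z * y)) ->
  exists (K : groupType) (p : {multiplicative G -> K}) (u : K -> T),
    bijective u /\ forall x, u (p x) = q x.
Proof.
move=> abG qT qM.
have qMr x y z : q x = q y -> q (x * z) = q (y * z).
  by rewrite !(abG _ z); exact: qM.
have /choice[s sK] : forall t, exists x, q x = t.
  by move=> t; have : setT t by []; rewrite -qT => -[x _]; exists x.
have sq x : q (s (q x)) = q x by exact: sK.
pose mul t t' := q (s t * s t').
pose inv t := q (s t)^-1.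
have mulA : associative mul.
  move=> t t' t''; rewrite /mul (qM _ _ _ (sq _)) mulgA.
  exact/esym/qMr/sq.
have mul1 : left_id (q 1) mul.
  by move=> t; rewrite /mul (qMr _ _ _ (sq _)) mul1g sK.
have mulr1 : right_id (q 1) mul.
  by move=> t; rewrite /mul (qM _ _ _ (sq _)) mulg1 sK.
have mulV : left_inverse (q 1) inv mul.
  by move=> t; rewrite /mul (qMr _ _ _ (sq _)) mulVg.
have mulrV : right_inverse (q 1) inv mul.
  by move=> t; rewrite /mul (qM _ _ _ (sq _)) mulgV.
pose C : choiceType := HB.pack T (gen_eqMixin T) (gen_choiceMixin T).
pose K : groupType := HB.pack T (gen_eqMixin T) (gen_choiceMixin T)
  (isGroup.Build C mulA mul1 mulr1 mulV mulrV).
have [p pE] : exists p : {multiplicative G -> K}, p =1 (q : G -> K).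
  apply: multiplicative_of_morph => x y.
  by rewrite -[RHS]/(mul (q x) (q y)) /mul (qM _ _ _ (sq _)) (qMr _ _ _ (sq _)).
by exists K, p, (fun k : K => (k : T)); split=> //; exists id.
Qed.

End GroupConstructions.

(** * Faithful minimal actions *)

Section MinimalActions.
Local Open Scope group_scope.

(** Continuity of each [A x] makes it a homeomorphism, with inverse [A x^-1]. *)
Definition minimal_faithful (G : groupType) (X : topologicalType)
    (A : G -> X -> X) : Prop :=
  [/\ forall z, A 1 z = z,
      forall x y z, A (x * y) z = A x (A y z),
      forall x, continuous (A x),
      forall x, (forall z, A x z = z) -> x = 1 &
      forall z, dense (range (A^~ z))].

Lemma subgroup_homeoE (X : topologicalType) (G : groupType) :
  (exists S : set (homeo X),
     [/\ subgroup S, minimal_action S & isomorphic_to_subgroup G S]) <->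
  (exists A : G -> X -> X, minimal_faithful A).
Proof.
split.
  move=> [S [sS mS [f [fS f_inj f_surj]]]].
  have fM : {morph f : x y / x * y} by exact: gmulfM.
  exists (fun x => homeo_fun (f x)); split=> [z|x y z|x|x fx|z].
  - by rewrite (morph1 fM).
  - by rewrite fM.
  - by case: (homeoP (f x)).
  - apply: f_inj; rewrite ?inE// (morph1 fM).
    by apply: homeo_eq => z; exact: fx.
  - move=> O O0 oO; have [y [Oy [g Sg gy]]] := mS z O O0 oO.
    have [x _ xg] := f_surj _ Sg.
    by exists y; split => //; exists x; rewrite ?xg.
move=> [A [A1 AM Ac Af Ad]].
have Ah x : homeomorphism (A x).
  split=> //; exists (A x^-1); split=> // z; rewrite -AM.
    by rewrite mulVg A1.
  by rewrite mulgV A1.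
pose f x := Homeo (Ah x).
have fM : {morph f : x y / x * y}.
  by move=> x y; apply: homeo_eq => z; exact: AM.
exists (range f); split; first exact: subgroup_range.
  move=> z O O0 oO; have [y [Oy [x _ xy]]] := Ad z O O0 oO.
  by exists y; split => //; exists (f x) => //; exists x.
apply: isomorphic_to_range => // x y fxy.
apply: (mulIg y^-1); rewrite mulgV; apply: Af => z.
have -> : A (x * y^-1) z = f x (A y^-1 z) by exact: AM.
by rewrite fxy /= -AM mulgV A1.
Qed.

Lemma minimal_faithful_homeomorphism (G : groupType) (X Y : topologicalType)
    (f : X -> Y) (g : Y -> X) (A : G -> X -> X) :
  cancel f g -> cancel g f -> continuous f -> continuous g ->
  minimal_faithful A -> minimal_faithful (fun x => f \o A x \o g).
Proof.
move=> fK gK cf cg [A1 AM Ac Af Ad]; split=> [z|x y z|x z|x Ax|z] /=.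
- by rewrite A1 gK.
- by rewrite AM fK.
- apply: continuous_comp; first exact: cg.
  by apply: continuous_comp; [exact: Ac|exact: cf].
- by apply: Af => z; have := Ax (f z); rewrite /= fK => /(can_inj fK).
- move=> O [y Oy] oO.
  have O'0 : f @^-1` O !=set0 by exists (g y); rewrite /= gK.
  have oO' : open (f @^-1` O) by apply: open_comp => // ? _; exact: cf.
  have [x [Ox [a _ ax]]] := Ad (g z) _ O'0 oO'.
  by exists (f x); split=> //; exists a; rewrite //= ax.
Qed.

Lemma minimal_faithful_homeomorphic (G : groupType) (X Y : topologicalType) :
  homeomorphic X Y ->
  (exists A : G -> X -> X, minimal_faithful A) <->
  (exists A : G -> Y -> Y, minimal_faithful A).
Proof.
move=> [f [cf [g [fK gK cg]]]]; split=> -[A mA].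
  by eexists; exact: (minimal_faithful_homeomorphism fK gK cf cg mA).
by eexists; exact: (minimal_faithful_homeomorphism gK fK cg cf mA).
Qed.

(** Since [G] is abelian, [x] fixes the whole orbit of [z], which is dense. A moved point [w] would
    have a neighbourhood of moved points, which that orbit meets. *)
Lemma minimal_abelian_free (G : groupType) (X : topologicalType)
    (A : G -> X -> X) : hausdorff_space X -> abelian_group G ->
  minimal_faithful A -> forall x z, A x z = z -> x = 1.
Proof.
rewrite open_hausdorff => hX abG [_ AM Ac Af Ad] x z xz; apply: Af => w.
apply: contrapT => /eqP/hX[[U V] /= [/set_mem Uw /set_mem Vw] [oU oV UV]].
have W0 : V `&` A x @^-1` U !=set0 by exists w.
have oW : open (V `&` A x @^-1` U).
  by apply: openI => //; apply: open_comp => // ? _; exact: Ac.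
have [w' [[Vw' Uw'] [y _ yw']]] := Ad z _ W0 oW.
suff : (U `&` V) w' by rewrite (eqP UV).
split=> //; suff <- : A x w' = w' by [].
by rewrite -yw' -AM abG AM xz.
Qed.

End MinimalActions.

Lemma continuous_sum_space (I : choiceType) (X : I -> topologicalType)
  (Z : topologicalType) (f : {i & X i} -> Z) :
  (forall i, continuous (f \o existT X i)) -> continuous f.
Proof. by move=> cf [i x] U nU; exact: cf. Qed.

(** * From a minimal action to an extension *)

Section CirclesToExtension.
Variables (R : realType) (l : nat).
Local Notation circles := {i : 'I_l & circle R}.

Lemma near_tag (T : topologicalType) (f : T -> circles) : continuous f ->
  forall t, \forall s \near t, tag (f s) = tag (f t).
Proof.
move=> cf t; apply: (cf t [set y | tag y = tag (f t)]).
by case: (f t) => i z; rewrite /nbhs /= sigT_nbhsE nbhs_simpl /=; apply: filterE.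
Qed.

(** The circle is the image of the line under [cis], and along the line the index is locally
    constant. *)
Lemma tag_circle_constant (f : circle R -> circles) z w : continuous f ->
  tag (f z) = tag (f w).
Proof.
move=> cf; have [t <-] := cis_surj z; have [s <-] := cis_surj w.
apply: (locally_constantE (f := fun t => tag (f (cis t)))).
apply: near_tag => u; apply: continuous_comp; last exact: cf.
exact: cis_continuous.
Qed.

Lemma tagged_continuous : continuous (fun y : circles => tagged y).
Proof. by apply: continuous_sum_space => i z; exact: cvg_id. Qed.

Local Open Scope group_scope.

Lemma circles_extension (G : groupType) (A : G -> circles -> circles) :
  (0 < l)%N -> abelian_group G -> minimal_faithful A ->
  exists (H K : groupType)
     (i : {multiplicative H -> G}) (p : {multiplicative G -> K}),
     [/\ abelian_group H /\ abelian_group K,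
         short_exact i p,
         exists D : set (circle R),
           [/\ subgroup D, dense D & isomorphic_to_subgroup H D]
       & ([set: K] #= `I_l)%card].
Proof.
move=> l0 abG mA; have [A1 AM Ac _ Ad] := mA.
have Afree : forall x z, A x z = z -> x = 1.
  apply: minimal_abelian_free abG mA.
  by apply: sigT_hausdorff => _; exact: circle_hausdorff.
pose i0 : 'I_l := Ordinal l0.
pose base z : circles := existT _ i0 z.
have comp_const x (y y' : circles) :
    tag y = tag y' -> tag (A x y) = tag (A x y').
  case: y y' => i z [i' z'] /= <-.
  apply: (tag_circle_constant (f := fun z => A x (existT _ i z))) => w.
  by apply: continuous_comp; [exact: existT_continuous|exact: Ac].
(* Each circle is open in the union, so density can be tested inside one circle; with the whole
   circle as [O] this gives transitivity on circles. *)
have orbit_meets y j (O : set (circle R)) : O !=set0 -> open O ->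
    (existT _ j @` O `&` range (A^~ y)) !=set0.
  move=> [z Oz] oO; apply: Ad; first by exists (existT _ j z), z.
  exact: existT_open_map.
(* The circle to which [x] carries the circle [i0]: it labels the coset of [x] modulo the stabiliser
   of [i0]. *)
pose q x := tag (A x (base 1)).
have q1 : q 1 = i0 by rewrite /q A1.
have qT : range q = setT.
  apply/seteqP; split=> // j _.
  have [_ [[z _ <-] [x _ xz]]] := orbit_meets (base 1) j setT (ex_intro _ 1 I) openT.
  by exists x; rewrite /q // xz.
have qM x y z : q x = q y -> q (z * x) = q (z * y).
  by rewrite /q !AM; exact: comp_const.
have [K [p [u [[v uK vK] up]]]] := group_of_quotient abG qT qM.
have pM : {morph p : x y / x * y} by exact: gmulfM.
have p_eq1 x : p x = 1 <-> q x = i0.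
  rewrite -up -q1 -up (morph1 pM).
  by split=> [->//|/(can_inj uK)].
have sS : subgroup [set x | q x = i0].
  split=> [|x y|x] /=; rewrite -?p_eq1 ?pM ?(morphV pM).
  - exact: morph1.
  - by move=> -> ->; rewrite mulg1.
  - by move=> ->; rewrite invg1.
have [H [i [i_inj iS]]] := group_of_subgroup sS.
have iM : {morph i : x y / x * y} by exact: gmulfM.
have qi h : q (i h) = i0.
  by have : range i (i h) by []; rewrite iS.
have psurj k : exists x, p x = k.
  have : setT (u k) by []; rewrite -qT => -[x _]; rewrite -up => /(can_inj uK).
  by exists x.
exists H, K, i, p; split.
- split=> [x y|x y]; first by apply: i_inj; rewrite !iM; exact: abG.
  have [x' <-] := psurj x; have [y' <-] := psurj y.
  by rewrite /commute -!pM abG.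
- split=> //.
    by rewrite iS; apply/seteqP; split=> x /=; rewrite p_eq1.
  by apply/seteqP; split=> // k _; have [x] := psurj k; exists x.
- pose b h z := tagged (A (i h) (base z)).
  have bE h z : A (i h) (base z) = base (b h z).
    have : tag (A (i h) (base z)) = i0 by rewrite -(qi h); exact: comp_const.
    by rewrite /b; case: (A _ _) => j w /= ->.
  have [|||||rho [rhoM rho_inj]] := @free_circle_action_embeds R H b.
  + by move=> x y; apply: i_inj; rewrite !iM; exact: abG.
  + by move=> z; rewrite /b (morph1 iM) A1.
  + by move=> x y z; rewrite /b iM AM bE.
  + move=> h z; apply: continuous_comp; last exact: tagged_continuous.
    by apply: continuous_comp; [exact: existT_continuous|exact: Ac].
  + move=> h z bz; apply: i_inj; rewrite (morph1 iM).
    by apply: (Afree _ (base z)); rewrite bE bz.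
  exists (range rho); split; [exact: subgroup_range| |exact: isomorphic_to_range].
  apply: infinite_subgroup_dense; first exact: subgroup_range.
  rewrite (eq_finite_set (inj_card_eq (in2W rho_inj))) => finH.
  (* If [H] is finite, the complement of its orbit of [1] is open. Were it nonempty, the [G]-orbit
     would meet it through an element preserving [i0], hence coming from [H]. So the circle would be
     finite. *)
  have orbit_closed : closed (range (b^~ 1)).
    have /hausdorff_accessible/accessible_finite_set_closed := @circle_hausdorff R.
    apply.
    exact: finite_image.
  apply: (@circle_infinite R); apply: sub_finite_set (finite_image (b^~ 1) finH).
  move=> z _; apply: contrapT => nz.
  have [_ [[w nw <-] [x _ xw]]] := orbit_meets (base 1) i0 _ (ex_intro _ z nz)
    (closed_openC orbit_closed).
  have : [set x | q x = i0] x by rewrite /q /= xw.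
  rewrite -iS => -[h _ hx]; apply: nw; exists h => //.
  by rewrite /b hx xw.
- apply: card_eq_trans (card_esym card_II).
  have <- : v @` [set: 'I_l] = [set: K].
    by apply/seteqP; split=> // k _; exists (u k).
  exact: inj_card_eq (in2W (can_inj vK)).
Qed.

End CirclesToExtension.

Lemma card_setT_bij (T U : Type) : ([set: T] #= [set: U])%card ->
  exists (f : T -> U) (g : U -> T), cancel f g /\ cancel g f.
Proof.
move=> /card_bijP[f [g fK gK]].
pose inT V (x : V) : set_type [set: V] := exist _ x (mem_set I).
have inTK V (y : set_type [set: V]) : inT V (val y) = y by exact: val_inj.
exists (fun x => val (f (inT T x))), (fun y => val (g (inT U y))).
by split=> x; rewrite inTK ?fK ?gK.
Qed.

(** * From an extension to a minimal action *)

Section ExtensionToCircles.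
Variables (R : realType) (l : nat).
Local Notation circles := {i : 'I_l & circle R}.
Local Open Scope group_scope.

(* The action of [G] on the bundle [G x_H circle] over [K = G / H], written in
   the trivialisation given by a section [s] of [p]. *)
Lemma extension_circles (G H K : groupType) (i : {multiplicative H -> G})
    (p : {multiplicative G -> K}) (D : set (circle R)) :
  abelian_group G -> short_exact i p ->
  dense D -> isomorphic_to_subgroup H D -> ([set: K] #= `I_l)%card ->
  exists A : G -> circles -> circles, minimal_faithful A.
Proof.
move=> abG [i_inj ip pT] dD [j [_ j_inj jD]] cK.
have iM : {morph i : x y / x * y} by exact: gmulfM.
have pM : {morph p : x y / x * y} by exact: gmulfM.
have jM : {morph j : x y / x * y} by exact: gmulfM.
have p1 := morph1 pM; have pV := morphV pM.
have [u [v [uK vK]]] := card_setT_bij (card_eq_trans cK card_II).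
have /choice[s sK] : forall k, exists x, p x = k.
  by move=> k; have : setT k by []; rewrite -pT => -[x _]; exists x.
have pi h : p (i h) = 1 by have : range i (i h) by []; rewrite ip.
(* An inverse of [i] on the kernel of [p]; the value [1] elsewhere is a default. *)
have /choice[r rK] : forall x, exists h, p x = 1 -> i h = x.
  move=> x; have [px|npx] := pselect (p x = 1); last by exists 1.
  by have : (p @^-1` [set 1]) x by []; rewrite -ip => -[h _ hx]; exists h.
pose chi x := j (r x).
have chiM x y : p x = 1 -> p y = 1 -> chi (x * y) = chi x * chi y.
  move=> px py; rewrite /chi -jM; congr (j _); apply: i_inj.
  by rewrite iM !rK// pM px py mulg1.
have chi_i h : chi (i h) = j h by congr (j _); apply: i_inj; rewrite rK.
(* The kernel element comparing [x * s k] with the chosen representative of its coset; the cocycle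
   identity [cM] below makes [A] an action. *)
pose c x k := x * s k * (s (p x * k))^-1.
have pc x k : p (c x k) = 1 by rewrite !pM pV !sK mulgV.
have cM x y k : c (x * y) k = c x (p y * k) * c y k.
  rewrite [RHS]abG /c pM -(mulgA (p x)).
  move: (s k) (s (p y * k)) (s (p x * _)) => a b d.
  by rewrite !mulgA (abG (y * a * b^-1) x) !mulgA mulgVK.
pose A x (y : circles) : circles :=
  existT _ (u (p x * v (tag y))) (chi (c x (v (tag y))) * tagged y).
exists A; split.
- move=> [n z]; rewrite /A /= p1 mul1g vK.
  by rewrite /c p1 !mul1g mulgV -(morph1 iM) chi_i (morph1 jM) mul1g.
- move=> x y [n z]; rewrite /A /= uK pM mulgA; congr existT.
  by rewrite cM chiM// mulgA.
- move=> x; apply: continuous_sum_space => n z.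
  apply: (@continuous_comp _ _ _ (fun w : circle R => chi _ * w)
    (existT (fun=> circle R) _)); first exact: circle_mul_continuous.
  exact: existT_continuous.
(* One point over [1] detects [x]: the index gives [p x = 1], then [c x 1] is [x] itself, and
   injectivity of [j] concludes. *)
- move=> x Ax; have := Ax (existT (fun=> circle R) (u 1) 1); rewrite /A /= uK mulg1 => xx.
  have /(can_inj uK) px : u (p x) = u 1 by exact: (congr1 (@tag _ _) xx).
  have := congr1 (fun y : circles => tagged y) xx.
  rewrite /= mulg1 /c px mulg1 mulgK /chi -(morph1 jM) => /j_inj rx.
  by rewrite -(rK x px) rx ?inE// (morph1 iM).
- move=> [m z] O [[n w] Ow] oO.
  (* The element [x0] carries the circle [m] to the circle [n] and [z] to [z0]; then [H] multiplies
     [z0] by elements of the dense set [D]. *)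
  pose x0 := s (v n * (v m)^-1).
  have px0 : p x0 * v m = v n by rewrite sK mulgVK.
  pose z0 := chi (c x0 (v m)) * z.
  pose O' := (fun y => existT _ n (z0 * y) : circles) @^-1` O.
  have oO' : open O'.
    apply: open_comp => // y _.
    apply: (@continuous_comp _ _ _ (fun w : circle R => z0 * w)
      (existT (fun=> circle R) _)); first exact: circle_mul_continuous.
    exact: existT_continuous.
  have O'0 : O' !=set0 by exists (z0^-1 * w); rewrite /O' /= mulVKg.
  have [y [Oy /jD[h _ hy]]] := dD _ O'0 oO'; rewrite -{}hy in Oy.
  exists (existT (fun=> circle R) n (z0 * j h)); split=> //; exists (i h * x0) => //.
  rewrite /A /= pM pi mul1g px0 vK; congr existT.
  rewrite (_ : c _ _ = i h * c x0 (v m)).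
    by rewrite chiM// chi_i -mulgA -/z0 circle_mulC.
  by rewrite /c pM pi mul1g !mulgA.
Qed.

End ExtensionToCircles.

Theorem theoremC (R : realType) (l : nat) (l_gt0 : (0 < l)%N)
    (X : topologicalType) (XE : disjoint_union_of_circles R l X)
    (G : groupType) (abG : abelian_group G) :
  (exists S : set (homeo X),
     [/\ subgroup S, minimal_action S & isomorphic_to_subgroup G S])
  <->
  (exists (H K : groupType)
     (i : {multiplicative H -> G}) (p : {multiplicative G -> K}),
     [/\ abelian_group H /\ abelian_group K,
         short_exact i p,
         exists D : set (circle R),
           [/\ subgroup D, dense D & isomorphic_to_subgroup H D]
       & ([set: K] #= `I_l)%card]).
Proof.
rewrite subgroup_homeoE (minimal_faithful_homeomorphic G XE); split.
  by move=> [A mA]; exact: circles_extension mA.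
move=> [H [K [i [p [_ ses [D [_ dD isoD]] cK]]]]].
exact: extension_circles abG ses dD isoD cK.
Qed.
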